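(* Let $f:\mathbb{R}^m\to\mathbb{R}$ be convex and differentiable such that $\nabla f$ is $L$-Lipschitz continuous with respect to the Euclidean norm, $L>0$. Let $\sigma\ge0$ and let $0<\eta<\frac{1}{L(1+\sigma^2)}$. Let $(X_n)_{n\ge0}$ be the stochastic gradient descent trajectory $X_{n+1}=X_n-\eta g_n$ with a (random) initial condition $X_0$ and gradient estimators $g_n$ such that, with $\mathcal{F}_n=\sigma(X_0,\dots,X_n)$ the $\sigma$-algebra generated by $X_0,\dots,X_n$, \[ \mathbb{E}[g_n\mid\mathcal{F}_n]=\nabla f(X_n),\qquad \mathbb{E}\big[\|g_n-\nabla f(X_n)\|^2\,\big|\,\mathcal{F}_n\big]\le\sigma^2\,\|\nabla f(X_n)\|^2\qquad\text{for all } n\ge 0. \] Then $\mathbb{E}[f(X_n)]$ is monotone decreasing in $n$. If moreover $x^*\in\mathbb{R}^m$ satisfies $f(x^* )=\inf f$, then \[ \eta\sum_{n=0}^\infty\mathbb{E}\big[f(X_n)-\inf f\big]\le\frac{\mathbb{E}\big[\|X_0-x^*\|^2\big]}{2}+\frac{\eta(1+\sigma^2)}{1-L(1+\sigma^2)\eta/2}\,\mathbb{E}\big[f(X_0)-\inf f\big]. \]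
   Context: All random variables are defined on a common probability space and take values in $\mathbb{R}^m$. $\|\cdot\|$ is the Euclidean norm. ''Monotone decreasing'' is meant in the non-strict sense. *)

(* Defs.v *)
From HB Require Import structures.
From mathcomp Require Import all_boot all_order all_algebra.
From mathcomp Require Import all_classical all_reals all_analysis.
From mathcomp Require Import measurable_realfun.

Set Implicit Arguments.
Unset Strict Implicit.
Unset Printing Implicit Defensive.

Import Order.TTheory GRing.Theory Num.Theory.
Import numFieldNormedType.Exports.

Local Open Scope classical_set_scope.
Local Open Scope ring_scope.

(* The library norm `|x| on row vectors is the sup norm; it induces the same
   topology, hence the same differentiability, as the Euclidean one. *)
Definition enorm (R : realType) (m : nat) (x : 'rV[R]_m) : R :=
  Num.sqrt (\sum_(i < m) x 0 i ^+ 2).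

Definition grad (R : realType) (m : nat) (f : 'rV[R]_m -> R) (x : 'rV[R]_m) :
    'rV[R]_m :=
  \row_(i < m) 'D_(delta_mx 0 i) f x.

(* Extended-real valued: the real-valued [inf] of a set that is not bounded
   below is an arbitrary number. *)
Definition inf_fun (R : realType) (m : nat) (f : 'rV[R]_m -> R) : \bar R :=
  ereal_inf (range (fun x => (f x)%:E)).

Definition random_vector (d : measure_display) (T : measurableType d)
    (R : realType) (m : nat) (Y : T -> 'rV[R]_m) : Prop :=
  forall i : 'I_m, measurable_fun setT (fun w => Y w 0 i).

(* sigma(X_0, ..., X_n): the Borel sets of R^m are generated by coordinates. *)
Definition natural_filtration (d : measure_display) (T : measurableType d)
    (R : realType) (m : nat) (X : nat -> T -> 'rV[R]_m) (n : nat) :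
    set (set T) :=
  <<s \bigcup_(k in [set k : nat | (k <= n)%N]) \bigcup_(i in [set: 'I_m])
        preimage_set_system setT (fun w => X k w 0 i) measurable >>.

(* Z is a version of E[Y | G], for Y integrable or nonnegative (in the second
   case both may be of infinite expectation). The defining equations force Z
   to be integrable, resp. almost everywhere nonnegative. *)
Definition is_cond_expectation (d : measure_display) (T : measurableType d)
    (R : realType) (P : probability T R) (G : set (set T))
    (Y Z : T -> \bar R) : Prop :=
  [/\ P.-integrable setT Y \/
        (measurable_fun setT Y /\ forall w, (0 <= Y w)%E),
      forall B : set (\bar R), measurable B -> G (Z @^-1` B) &
      forall A : set T, G A ->
        (\int[P]_(w in A) Y w = \int[P]_(w in A) Z w)%E].

Definition is_cond_expectation_vec (d : measure_display)
    (T : measurableType d) (R : realType) (P : probability T R)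
    (G : set (set T)) (m : nat) (Y Z : T -> 'rV[R]_m) : Prop :=
  forall i : 'I_m, P.-integrable setT (fun w => (Y w 0 i)%:E) /\
    is_cond_expectation P G
      (fun w => (Y w 0 i)%:E) (fun w => (Z w 0 i)%:E).

(* E[Y | G] <= U almost surely. *)
Definition cond_expectation_le (d : measure_display) (T : measurableType d)
    (R : realType) (P : probability T R) (G : set (set T))
    (Y U : T -> \bar R) : Prop :=
  exists2 Z : T -> \bar R, is_cond_expectation P G Y Z &
    {ae P, forall w, (Z w <= U w)%E}.

(* Main.v *)
(** Write [V = grad f X_n].  The descent lemma and the variance bound give, on
    events of F_n where X_n is bounded,
      E[f X_{n+1}] <= E[f X_n] - eta (1 - L eta (1 + sigma^2) / 2) E[|V|^2],
    and expanding the square together with the gradient inequality of convexity,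
      E[|X_{n+1} - xs|^2]
        <= E[|X_n - xs|^2] - 2 eta E[f X_n - f xs] + eta^2 (1 + sigma^2) E[|V|^2].
    With K = eta (1 + sigma^2) / (1 - L (1 + sigma^2) eta / 2), the potential
    Phi_n = |X_n - xs|^2 / 2 + (K / 2) (f X_n - f xs) absorbs the |V|^2 terms, so
    E[Phi_{n+1}] + eta E[f X_n - f xs] <= E[Phi_n], which telescopes.  Since no
    integrability of f X_n is assumed, each step is rearranged into an inequality
    between integrals of nonnegative functions, and the bounded events are then
    exhausted by monotone convergence. *)
Require Import Defs.
From HB Require Import structures.
From mathcomp Require Import all_boot all_order all_algebra.
From mathcomp Require Import all_classical all_reals all_analysis.
From mathcomp Require Import measurable_realfun.
From mathcomp Require Import ring lra.

Set Implicit Arguments.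
Unset Strict Implicit.
Unset Printing Implicit Defensive.

Import Order.TTheory GRing.Theory Num.Theory.
Import numFieldNormedType.Exports.

Local Open Scope classical_set_scope.
Local Open Scope ring_scope.

(** * Smooth convex functions *)

Definition dotr (R : realType) (m : nat) (u v : 'rV[R]_m) : R :=
  \sum_(i < m) u 0 i * v 0 i.

Section dot_product.
Context {R : realType} {m : nat}.
Implicit Types u v x y : 'rV[R]_m.

Lemma dotrC u v : dotr u v = dotr v u.
Proof. by apply: eq_bigr => i _; rewrite mulrC. Qed.

Lemma dotrDr u v y : dotr u (v + y) = dotr u v + dotr u y.
Proof. by rewrite -big_split; apply: eq_bigr => i _; rewrite mxE mulrDr. Qed.

Lemma dotrDl u v y : dotr (u + v) y = dotr u y + dotr v y.
Proof. by rewrite dotrC dotrDr !(dotrC y). Qed.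

Lemma dotrZr a u v : dotr u (a *: v) = a * dotr u v.
Proof. by rewrite mulr_sumr; apply: eq_bigr => i _; rewrite mxE mulrCA. Qed.

Lemma dotrZl a u v : dotr (a *: u) v = a * dotr u v.
Proof. by rewrite dotrC dotrZr dotrC. Qed.

Lemma dotrNr u v : dotr u (- v) = - dotr u v.
Proof. by rewrite -scaleN1r dotrZr mulN1r. Qed.

Lemma dotrNl u v : dotr (- u) v = - dotr u v.
Proof. by rewrite dotrC dotrNr dotrC. Qed.

Lemma dotr_ge0 u : 0 <= dotr u u.
Proof. by apply: sumr_ge0 => i _; rewrite -expr2 sqr_ge0. Qed.

Lemma enorm_ge0 u : 0 <= enorm u.
Proof. exact: sqrtr_ge0. Qed.

Lemma enorm_sqr u : enorm u ^+ 2 = dotr u u.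
Proof.
rewrite /enorm sqr_sqrtr; first by apply: eq_bigr => i _; rewrite expr2.
by apply: sumr_ge0 => i _; rewrite sqr_ge0.
Qed.

Lemma enormZ a u : enorm (a *: u) = `|a| * enorm u.
Proof.
rewrite /enorm -sqrtr_sqr -sqrtrM ?sqr_ge0// mulr_sumr.
by congr Num.sqrt; apply: eq_bigr => i _; rewrite mxE exprMn.
Qed.

Lemma enorm0_eq0 u : enorm u = 0 -> u = 0.
Proof.
move=> u0; have := enorm_sqr u; rewrite u0 expr0n/= => /esym/eqP.
rewrite psumr_eq0 => [/allP h|i _]; last by rewrite -expr2 sqr_ge0.
apply/rowP => i; rewrite mxE; apply/eqP.
by have := h i (mem_index_enum _); rewrite implyTb -expr2 sqrf_eq0.
Qed.

(** Cauchy-Schwarz: expand the nonnegative square of [enorm v *: u - enorm u *: v] and divide by the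
    product of the two norms, the zero cases being treated apart. *)
Lemma dotr_le_enorm u v : dotr u v <= enorm u * enorm v.
Proof.
have [/enorm0_eq0 ->|a0] := eqVneq (enorm u) 0.
  by rewrite -(scale0r 0) dotrZl mul0r mulr_ge0// enorm_ge0.
have [/enorm0_eq0 ->|b0] := eqVneq (enorm v) 0.
  by rewrite -(scale0r 0) dotrZr mul0r mulr_ge0// enorm_ge0.
have ab0 : 0 < enorm u * enorm v.
  by rewrite mulr_gt0// lt0r enorm_ge0 ?a0 ?b0.
have := dotr_ge0 (enorm v *: u - enorm u *: v).
rewrite !(dotrDl, dotrDr, dotrNl, dotrNr, dotrZl, dotrZr) (dotrC v u).
rewrite -!enorm_sqr => h.
by rewrite -subr_ge0 -(pmulr_rge0 _ ab0); nra.
Qed.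

End dot_product.

(** * Taylor bounds from a Lipschitz gradient, and the gradient inequality *)

Section smooth_convex.
Context {R : realType} {m : nat} {f : 'rV[R]_m -> R}.
Hypothesis f_diff : forall x, differentiable f x.
Implicit Types x y v : 'rV[R]_m.

Lemma derive_grad x v : 'D_v f x = dotr (grad f x) v.
Proof.
rewrite deriveE// [in LHS](row_sum_delta v) linear_sum.
apply: eq_bigr => i _; rewrite linearZ mxE deriveE//.
exact: mulrC.
Qed.

(** The difference quotient in [t] is literally that of [f] at [x + t *: v] in direction [v], so no
    chain rule is invoked. *)
Lemma is_derive_line x v (t : R) :
  is_derive t 1 (fun t => f (x + t *: v)) (dotr (grad f (x + t *: v)) v).
Proof.
have quotE (h : R) : h^-1 *: (f (x + (h *: 1 + t) *: v) - f (x + t *: v)) =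
    h^-1 *: (f (h *: v + (x + t *: v)) - f (x + t *: v)).
  by rewrite scalerDl -scalerA scale1r addrCA.
have fv : derivable f (x + t *: v) v by exact: diff_derivable.
apply: DeriveDef.
- by rewrite /derivable; under eq_fun do rewrite quotE.
- by rewrite /derive; under eq_fun do rewrite quotE; exact: derive_grad.
Qed.

Context {L : R}.
Hypothesis f_smooth :
  forall x y, enorm (grad f x - grad f y) <= L * enorm (x - y).

(* The sign [s] treats the upper and the lower Taylor bound at once. *)
Lemma smooth_taylor (s : R) x v : `|s| = 1 ->
  s * (f (x + v) - f x - dotr (grad f x) v) <= L / 2 * enorm v ^+ 2.
Proof.
move=> s1.
(* The quadratic correction makes the derivative [dphi] nonpositive on [0, 1]; the mean value
   theorem then gives [phi 1 <= phi 0], which is the claim. *)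
pose phi t : R := s * (f (x + t *: v) - t * dotr (grad f x) v)
  - L / 2 * enorm v ^+ 2 * t ^+ 2.
pose dphi t : R := s * (dotr (grad f (x + t *: v)) v - dotr (grad f x) v)
  - L * enorm v ^+ 2 * t.
have dp (t : R) : is_derive t 1 phi (dphi t).
  have H := is_derive_line x v t.
  apply: is_derive_eq.
  by rewrite /dphi /GRing.scale/=; field.
have [|c] := @MVT R phi dphi 0 1 ltr01 (fun t _ => dp t).
  apply: derivable_within_continuous => t _; exact: ex_derive.
rewrite in_itv/= => /andP[c0 c1]; rewrite subr0 mulr1 => phi01.
have : dphi c <= 0.
  rewrite subr_le0.
  have -> : s * (dotr (grad f (x + c *: v)) v - dotr (grad f x) v) =
    dotr (s *: (grad f (x + c *: v) - grad f x)) v.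
    by rewrite dotrZl dotrDl dotrNl.
  apply: (le_trans (dotr_le_enorm _ _)); rewrite enormZ s1 mul1r.
  rewrite expr2 mulrA -mulrAC ler_wpM2r ?enorm_ge0//.
  apply: (le_trans (f_smooth _ _)).
  by rewrite addrC addKr enormZ (gtr0_norm c0) -mulrA (mulrC c).
rewrite -phi01 /phi !scale0r scale1r addr0 expr0n/= expr1n; lra.
Qed.

Lemma smooth_upper_bound x v :
  f (x + v) <= f x + dotr (grad f x) v + L / 2 * enorm v ^+ 2.
Proof. by have := @smooth_taylor 1 x v (normr1 _); lra. Qed.

Hypothesis f_convex : convex_function setT f.

(* Compare convexity on [[x, x + t (y - x)]] with the lower Taylor bound, divide
   by [t], and let [t] tend to [0]. *)
Lemma convex_gradient_ineq x y : dotr (grad f x) (y - x) <= f y - f x.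
Proof.
set v := y - x; set q := L / 2 * enorm v ^+ 2.
have lin (t : R) : 0 < t -> t <= 1 ->
    dotr (grad f x) v <= f y - f x + q * t.
  move=> t0 t1.
  have conv_t : f (x + t *: v) <= t * f y + (1 - t) * f x.
    have -> : x + t *: v = t *: y + (1 - t) *: x.
      by rewrite scalerBl scale1r scalerBr addrCA.
    by apply: (f_convex (Itv01 (ltW t0) t1)); rewrite inE.
  have := @smooth_taylor (-1) x (t *: v) (normrN1 _).
  rewrite dotrZr enormZ (gtr0_norm t0) exprMn => taylor_t.
  rewrite -(ler_pM2l t0) /q; lra.
apply/ler_addgt0Pl => e e0.
(* The witness [t = e / (e + |q|)] lies in ]0, 1] and satisfies [q * t <= e]. *)
have tq : 0 < e / (e + `|q|) by rewrite divr_gt0// ltr_wpDr.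
have t1 : e / (e + `|q|) <= 1.
  by rewrite ler_pdivrMr ?mul1r ?lerDl// ltr_wpDr.
apply: (le_trans (lin _ tq t1)); rewrite addrC lerD2r.
rewrite mulrCA ler_piMr ?(ltW e0)// ler_pdivrMr ?ltr_wpDr// mul1r.
by rewrite (le_trans (ler_norm q))// lerDr ltW.
Qed.

End smooth_convex.

(** * Measurability and factoring out known factors *)

Section measurability.
Context {d : measure_display} {S : measurableType d} {R : realType} {m : nat}.

(* [f] is the pointwise limit of its values on the grids of mesh [1 / k]. *)
Lemma measurable_continuous_rV (f : 'rV[R]_m -> R) (Y : S -> 'rV[R]_m) :
  continuous f -> random_vector Y -> measurable_fun setT (f \o Y).
Proof.
move=> fc mY.
pose z k (x : 'rV[R]_m) : 'rV[int]_m := \row_i Num.floor (x 0 i * k.+1%:R).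
pose q k (v : 'rV[int]_m) : 'rV[R]_m := \row_i ((v 0 i)%:~R / k.+1%:R).
apply: (@measurable_fun_cvg _ _ _ _ (fun k w => f (q k (z k (Y w))))); last first.
  move=> w _; apply: continuous_cvg; first exact: fc.
  apply/cvg_ballP => e e0; near=> k.
  split=> // i j; rewrite ord1 /ball/= /ball_/= !mxE.
  have k0 : 0 < k.+1%:R :> R by rewrite ltr0n.
  have -> : Y w 0 j = Y w 0 j * k.+1%:R / k.+1%:R by rewrite mulfK// gt_eqF.
  rewrite -mulrBl normrM (gtr0_norm (_ : 0 < k.+1%:R^-1)) ?invr_gt0//.
  have /andP[fl fu] := floor_itv (Y w 0 j * k.+1%:R).
  rewrite ger0_norm ?subr_ge0// mulfK ?gt_eqF//.
  apply: (@le_lt_trans _ _ k.+1%:R^-1).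
    by rewrite ler_piMl ?invr_ge0 ?(ltW k0)//; rewrite intrD in fu; lra.
  by near: k; exact: (near_infty_natSinv_lt (PosNum e0)).
move=> k _ B mB; rewrite setTI.
(* Rounding takes values in the countable type of integer vectors, so the preimage is a countable
   union of coordinate boxes. *)
have -> : (fun w => f (q k (z k (Y w)))) @^-1` B =
    \bigcup_(v in [set: 'rV[int]_m]) [set w | z k (Y w) = v /\ B (f (q k v))].
  apply/seteqP; split => w /=; first by exists (z k (Y w)).
  by case=> v _ /= [<-].
apply: countable_bigcupT_measurable => [|v]; first exact: countableP.
have [Bv|nBv] := pselect (B (f (q k v))); last first.
  by rewrite (_ : mkset _ = set0)//; apply/seteqP; split => w //= [].
rewrite (_ : mkset _ = \bigcap_(i in [set: 'I_m])
    ((fun w => Y w 0 i * k.+1%:R) @^-1` `[(v 0 i)%:~R, (v 0 i + 1)%:~R[)).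
  apply: fin_bigcap_measurable => // i _; rewrite -[X in measurable X]setTI.
  by apply: measurable_funM => //; exact: mY.
apply/seteqP; split => w /=.
  move=> [zv _] i _ /=; rewrite -zv mxE in_itv/=; exact: floor_itv.
move=> h; split=> //; apply/rowP => i; rewrite mxE.
by apply/floor_def; have := h i I; rewrite /= in_itv.
Unshelve. all: end_near. Qed.

Lemma measurable_dotr (Y Z : S -> 'rV[R]_m) :
  random_vector Y -> random_vector Z ->
  measurable_fun setT (fun w => dotr (Y w) (Z w)).
Proof.
by move=> mY mZ; apply: measurable_sum => i; apply: measurable_funM.
Qed.

Lemma random_vectorD (Y Z : S -> 'rV[R]_m) :
  random_vector Y -> random_vector Z -> random_vector (fun w => Y w + Z w).
Proof.
move=> mY mZ i; apply: (eq_measurable_fun (fun w => Y w 0 i + Z w 0 i)).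
  by move=> w _; rewrite mxE.
exact: measurable_funD.
Qed.

Lemma random_vectorZ (a : R) (Y : S -> 'rV[R]_m) :
  random_vector Y -> random_vector (fun w => a *: Y w).
Proof.
move=> mY i; apply: (eq_measurable_fun (fun w => a * Y w 0 i)).
  by move=> w _; rewrite mxE.
exact: measurable_funM.
Qed.

Lemma random_vectorN (Y : S -> 'rV[R]_m) :
  random_vector Y -> random_vector (fun w => - Y w).
Proof.
by move=> mY; under eq_fun do rewrite -scaleN1r; exact: random_vectorZ.
Qed.

End measurability.

(** * Multiplying a variable of zero conditional mean by a bounded known factor *)

Section taking_out.
Context {d : measure_display} {T : measurableType d} {R : realType}.
Context {P : {finite_measure set T -> \bar R}} {gen : set (set T)}.
Hypothesis sub_measurable : <<s gen >> `<=` measurable.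
Context {W : T -> R}.
Hypotheses (intW : P.-integrable setT (EFin \o W))
  (intW0 : forall A, <<s gen >> A -> \int[P]_(w in A) W w = 0).
Context {h : T -> R}.
Hypothesis mh : measurable_fun setT (h : g_sigma_algebraType gen -> R).

Let mh' : measurable_fun setT h.
Proof. by move=> _ B mB; apply: sub_measurable; exact: mh. Qed.

Lemma integrable_bounded_mul A (M : R) : measurable A ->
  (forall w, A w -> `|h w| <= M) -> P.-integrable A (EFin \o (fun w => h w * W w)).
Proof.
move=> mA hM.
have := @integrableMr _ _ _ P A mA h (EFin \o W).
apply.
- exact: measurable_funTS.
- by exists M; split; [exact: num_real|move=> x Mx w Aw; exact: le_trans (hM _ Aw) (ltW Mx)].
- by apply: integrableS intW.
Qed.

Let intWS B : <<s gen >> B -> P.-integrable B (EFin \o W).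
Proof. by move=> /sub_measurable mB; apply: integrableS intW. Qed.

Let intnW B : <<s gen >> B -> P.-integrable B (EFin \o (fun w => `|W w|)).
Proof. by move=> sB; apply: integrable_norm; exact: intWS. Qed.

Let inthW A (a delta : R) : <<s gen >> A ->
  (forall w, A w -> a <= h w <= a + delta) ->
  P.-integrable A (EFin \o (fun w => h w * W w)).
Proof.
move=> sA hA.
apply: (integrable_bounded_mul (M := `|a| + `|a + delta|)).
  exact: sub_measurable.
move=> w /hA /andP[h1 h2]; rewrite ler_norml.
have := ler_norm (a + delta); have := ler_norm (- a); rewrite normrN.
have := normr_ge0 a; have := normr_ge0 (a + delta); lra.
Qed.

(** Since [a * W] integrates to zero over [A], only [(h - a) * W] contributes, and [h - a] is at
    most [delta] there. *)
Let Rintegral_mul_slice A (a delta : R) : <<s gen >> A ->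
  (forall w, A w -> a <= h w <= a + delta) ->
  `|\int[P]_(w in A) (h w * W w)| <= delta * \int[P]_(w in A) `|W w|.
Proof.
move=> sA hA; have mA := sub_measurable sA.
have intaW : P.-integrable A (EFin \o (fun w => a * W w)).
  exact: (integrableZl mA a (intWS sA)).
have intd : P.-integrable A (EFin \o (fun w => (h w - a) * W w)).
  apply: (eq_integrable mA _ _ _ (integrableB mA (inthW sA hA) intaW)).
  by move=> w _; rewrite /= -EFinB mulrBl.
have -> : \int[P]_(w in A) (h w * W w) = \int[P]_(w in A) ((h w - a) * W w).
  under [RHS]eq_Rintegral do rewrite mulrBl.
  rewrite RintegralB//; last exact: (inthW sA hA).
  by rewrite RintegralZl ?intWS// intW0// mulr0 subr0.
apply: (le_trans (le_normr_Rintegral mA intd)).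
rewrite -RintegralZl ?intnW//; apply: le_Rintegral => //.
- exact: integrable_norm.
- exact: (integrableZl mA delta (intnW sA)).
move=> w /hA /andP[h1 h2]; rewrite normrM ler_wpM2r// ger0_norm; lra.
Qed.

(** Induction on the number of slices, splitting off the top one at level [c]. Each slice costs
    [delta] times its own share of the integral of [|W|], so the bound does not grow with [n]. *)
Let Rintegral_mul_slices (delta : R) n (a : R) A : 0 <= delta -> <<s gen >> A ->
  (forall w, A w -> a <= h w <= a + n.+1%:R * delta) ->
  `|\int[P]_(w in A) (h w * W w)| <= delta * \int[P]_(w in A) `|W w|.
Proof.
move=> delta0; elim: n A => [|n IH] A sA hA.
  by apply: (@Rintegral_mul_slice _ a) => // w /hA; rewrite mul1r.
pose c := a + n.+1%:R * delta.
pose A1 := A `&` [set w | h w <= c]; pose A2 := A `&` [set w | c < h w].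
have sA1 : <<s gen >> A1.
  apply: (@measurableI _ (g_sigma_algebraType gen)) => //.
  by rewrite -[X in measurable X]setTI; apply: measurable_fun_ler.
have sA2 : <<s gen >> A2.
  apply: (@measurableI _ (g_sigma_algebraType gen)) => //.
  by rewrite -[X in measurable X]setTI; apply: measurable_fun_ltr.
have AE : A = A1 `|` A2.
  apply/seteqP; split=> w; last by case=> -[].
  by move=> Aw; have [?|?] := leP (h w) c; [left|right].
have dA : [disjoint A1 & A2].
  by apply/disj_setPS => w [[_ /= h1] [_ /=]]; rewrite ltNge h1.
have [mA1 mA2] := (sub_measurable sA1, sub_measurable sA2).
have IA1 : `|\int[P]_(w in A1) (h w * W w)| <= delta * \int[P]_(w in A1) `|W w|.
  by apply: IH => // w [/hA /andP[-> _] hc].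
have IA2 : `|\int[P]_(w in A2) (h w * W w)| <= delta * \int[P]_(w in A2) `|W w|.
  apply: (@Rintegral_mul_slice _ c) => // w [/hA /andP[_ h2] /= /ltW ->].
  by rewrite (le_trans h2)// /c -addrA lerD2l -[in leLHS]natr1 mulrDl mul1r.
rewrite AE !Rintegral_setU -?AE//; [|exact: intnW|exact: inthW hA].
by rewrite mulrDr (le_trans (ler_normD _ _))// lerD.
Qed.

(* Cutting the range of [h] into [n] levels leaves an error of order [1 / n]. *)
Lemma Rintegral_taking_out A (M : R) : <<s gen >> A ->
  (forall w, A w -> `|h w| <= M) -> \int[P]_(w in A) (h w * W w) = 0.
Proof.
move=> sA hM; set J := \int[P]_(w in A) `|W w|.
have J0 : 0 <= J by apply: Rintegral_ge0.
apply/eqP; rewrite -normr_le0; apply/ler_addgt0Pl => e e0; rewrite addr0.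
(* Chosen so that [2 * |M| * J / e < n.+1], which is what [delta * J <= e] requires. *)
pose n := Num.truncn (2 * `|M| * J / e).
pose delta : R := 2 * `|M| / n.+1%:R.
apply: (@le_trans _ _ (delta * J)).
  apply: (@Rintegral_mul_slices _ n (- `|M|)) => //; first by rewrite divr_ge0.
  move=> w /hM; rewrite /delta mulrCA divff ?pnatr_eq0// mulr1 ler_norml.
  have := ler_norm M; have := ler_norm (- M); rewrite normrN; lra.
rewrite /delta mulrAC ler_pdivrMr ?ltr0n// (mulrC e) -ler_pdivrMr//.
exact/ltW/truncnS_gt.
Qed.

End taking_out.

(** * Conditional expectations *)

Section conditional_expectation.
Context {d : measure_display} {T : measurableType d} {R : realType}.
Context {P : probability T R} {gen : set (set T)}.
Hypothesis sub_measurable : <<s gen >> `<=` measurable.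

(** The event [Z >= 0] and its complement belong to the sub-sigma-algebra. On each of them [|Z|] is
    [Z] or [- Z], whose integral is up to sign that of [Y], hence finite. *)
Lemma cond_expectation_integrable (Y Z : T -> \bar R) :
  P.-integrable setT Y -> is_cond_expectation P <<s gen >> Y Z ->
  P.-integrable setT Z.
Proof.
move=> intY [_ GZ YZ].
have mZ : measurable_fun setT Z.
  by move=> _ B mB; rewrite setTI; apply: sub_measurable; exact: GZ.
pose B := Z @^-1` `[0%E, +oo[.
have sB : <<s gen >> B by apply: GZ; exact: emeasurable_itv.
have sC : <<s gen >> (~` B) by exact: sigma_algebraC.
have [mB mC] := (sub_measurable sB, sub_measurable sC).
have intYS A : <<s gen >> A -> P.-integrable A Y.
  by move=> /sub_measurable mA; exact: integrableS intY.
apply/integrableP; split=> //.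
rewrite -(setUv B) ge0_integral_setU//; last 2 first.
- by apply: measurableT_comp => //; exact: measurable_funTS.
- by apply/disj_setPCl.
rewrite lte_add_pinfty//.
- rewrite (_ : integral _ _ _ = \int[P]_(w in B) Z w)%E.
    by rewrite -YZ//; apply: integrable_lty => //; exact: intYS.
  apply: eq_integral => w; rewrite inE /B/= in_itv/= => /andP[Z0 _].
  by rewrite gee0_abs.
- rewrite (_ : integral _ _ _ = - \int[P]_(w in ~` B) Z w)%E.
    rewrite -YZ//; have := integrable_fin_num mC (intYS _ sC).
    by rewrite -fin_numN => /fin_numPlt/andP[].
  rewrite -[LHS]oppeK -integral_ge0N//; congr (- _)%E.
  apply: eq_integral => w; rewrite inE /B/= in_itv/= => /negP.
  by rewrite andbT -ltNge => /ltW Z0; rewrite lee0_abs// oppeK.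
Qed.

(** Apply the previous section to [W = Y - Z], whose integral vanishes on every event of the
    sub-sigma-algebra. *)
Lemma Rintegral_cond_expectation_mul (Y Z h : T -> R) A (M : R) :
  P.-integrable setT (EFin \o Y) ->
  is_cond_expectation P <<s gen >> (EFin \o Y) (EFin \o Z) ->
  measurable_fun setT (h : g_sigma_algebraType gen -> R) ->
  <<s gen >> A -> (forall w, A w -> `|h w| <= M) ->
  [/\ P.-integrable A (EFin \o (fun w => h w * Y w)),
      P.-integrable A (EFin \o (fun w => h w * Z w)) &
      \int[P]_(w in A) (h w * Y w) = \int[P]_(w in A) (h w * Z w)].
Proof.
move=> intY YZ mh sA hM.
have intZ := cond_expectation_integrable intY YZ.
have [_ _ eqYZ] := YZ; have mA := sub_measurable sA.
have intW : P.-integrable setT (EFin \o (fun w => Y w - Z w)).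
  exact: (integrableB _ intY intZ).
have intW0 B : <<s gen >> B -> \int[P]_(w in B) (Y w - Z w) = 0.
  move=> sB; have mB := sub_measurable sB.
  have intS K : P.-integrable setT K -> P.-integrable B K by exact: integrableS.
  by rewrite RintegralB ?/Rintegral ?(eqYZ _ sB) ?subrr//; exact: intS.
have hY := integrable_bounded_mul sub_measurable intY mh mA hM.
have hZ := integrable_bounded_mul sub_measurable intZ mh mA hM.
split=> //; apply/eqP; rewrite -subr_eq0 -RintegralB//; apply/eqP.
under eq_Rintegral do rewrite -mulrBr.
exact: (Rintegral_taking_out sub_measurable intW intW0 mh sA hM).
Qed.

End conditional_expectation.

(** * Integral consequences of the conditional mean and variance assumptions *)

Section conditional_mean_and_variance.
Context {d : measure_display} {T : measurableType d} {R : realType} {m : nat}.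
Context {P : probability T R} {gen : set (set T)}.
Hypothesis sub_measurable : <<s gen >> `<=` measurable.
Context {g V : T -> 'rV[R]_m}.
Hypotheses (mg : random_vector g)
  (g_mean : is_cond_expectation_vec P <<s gen >> g V).

Definition gen_random_vector (K : T -> 'rV[R]_m) :=
  random_vector (K : g_sigma_algebraType gen -> 'rV[R]_m).

Lemma gen_random_vectorW K : gen_random_vector K -> random_vector K.
Proof. by move=> mK i _ B mB; apply: sub_measurable; exact: mK. Qed.

Lemma cond_mean_measurable : gen_random_vector V.
Proof.
move=> i; apply/measurable_EFinP => _ B mB; rewrite setTI.
by have [_ [_ + _]] := g_mean i; apply.
Qed.

Let mV := gen_random_vectorW cond_mean_measurable.

Lemma Rintegral_cond_mean_dotr (K : T -> 'rV[R]_m) A (M : R) :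
  gen_random_vector K -> <<s gen >> A ->
  (forall w i, A w -> `|K w 0 i| <= M) ->
  [/\ P.-integrable A (EFin \o (fun w => dotr (K w) (g w))),
      P.-integrable A (EFin \o (fun w => dotr (K w) (V w))) &
      \int[P]_(w in A) dotr (K w) (g w) = \int[P]_(w in A) dotr (K w) (V w)].
Proof.
move=> mK sA KM; have mA := sub_measurable sA.
have H i := Rintegral_cond_expectation_mul sub_measurable
  (proj1 (g_mean i)) (proj2 (g_mean i)) (mK i) sA (KM ^~ i).
have sumE (u : T -> 'rV[R]_m) : EFin \o (fun w => dotr (K w) (u w)) =
    fun w => (\sum_(i < m) (K w 0 i * u w 0 i)%:E)%E.
  by apply/funext => w; rewrite /= -sumEFin.
split.
- rewrite sumE; apply: integrable_sum => // i _.
  by have [] := H i.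
- rewrite sumE; apply: integrable_sum => // i _.
  by have [] := H i.
rewrite /Rintegral.
under eq_integral do rewrite -sumEFin.
under [in RHS]eq_integral do rewrite -sumEFin.
rewrite !integral_sum//; [|by move=> i; have [_] := H i|by move=> i; have [] := H i].
congr fine; apply: eq_bigr => i _.
have [iY iZ E] := H i; move: (congr1 EFin E).
by rewrite /Rintegral !fineK//; exact: integrable_fin_num.
Qed.

Context {sigma : R}.
Hypothesis g_var : cond_expectation_le P <<s gen >>
  (fun w => (enorm (g w - V w) ^+ 2)%:E)
  (fun w => (sigma ^+ 2 * enorm (V w) ^+ 2)%:E).

Lemma cond_variance_integral_le A : <<s gen >> A ->
  (\int[P]_(w in A) (enorm (g w - V w) ^+ 2)%:E <=
   \int[P]_(w in A) (sigma ^+ 2 * enorm (V w) ^+ 2)%:E)%E.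
Proof.
move=> sA; have mA := sub_measurable sA.
have [Z [_ GZ ->//] ZU] := g_var.
have mZ : measurable_fun setT Z.
  by move=> _ B mB; rewrite setTI; apply: sub_measurable; exact: GZ.
(* The bound on [Z] holds only almost everywhere and [Z] may be negative somewhere; passing to its
   positive part allows monotonicity for nonnegative integrands. *)
rewrite integralE; apply: (@le_trans _ _ (\int[P]_(w in A) Z^\+ w)%E).
  by rewrite geeDl// oppe_le0; exact: integral_ge0.
apply: ae_ge0_le_integral => //.
- by apply: measurable_funepos; exact: measurable_funTS.
- by move=> w _; rewrite lee_fin mulr_ge0 ?sqr_ge0.
- apply/measurable_EFinP; apply: measurable_funM => //.
  under eq_fun do rewrite enorm_sqr.
  by apply: measurable_funTS; exact: measurable_dotr.
apply: filterS ZU => w Zw _; rewrite funeposE ge_max Zw lee_fin.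
by rewrite mulr_ge0 ?sqr_ge0.
Qed.

Context {H : T -> 'rV[R]_m} {C : R}.
Hypotheses (mH : gen_random_vector H) (C0 : 0 <= C).

(* [dotr H g + C * enorm g ^+ 2] minus an upper bound of its conditional mean. *)
Let gap w := dotr (H w) (g w) + C * enorm (g w) ^+ 2
  - (dotr (H w) (V w) + C * (1 + sigma ^+ 2) * enorm (V w) ^+ 2).

(** Since |g|^2 = |g - V|^2 + 2<V, g> - |V|^2, [gap] equals <K, g - V> with K = H + 2CV, of integral
    zero, plus C (|g - V|^2 - sigma^2 |V|^2), of nonpositive integral. *)
Lemma Rintegral_gap_le0 A (M : R) : <<s gen >> A ->
  (forall w i, A w -> `|H w 0 i| <= M) -> (forall w i, A w -> `|V w 0 i| <= M) ->
  P.-integrable A (EFin \o gap) /\ \int[P]_(w in A) gap w <= 0.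
Proof.
move=> sA HM VM; have mA := sub_measurable sA.
pose K w := H w + (2 * C) *: V w.
have mK : gen_random_vector K.
  by apply: random_vectorD => //; apply: random_vectorZ; exact: cond_mean_measurable.
have KM w i : A w -> `|K w 0 i| <= M + `|2 * C| * M.
  move=> Aw; rewrite !mxE (le_trans (ler_normD _ _))// lerD ?HM//.
  by rewrite normrM ler_wpM2l// VM.
have [iKg iKV KgV] := Rintegral_cond_mean_dotr mK sA KM.
have [_ iVV _] := Rintegral_cond_mean_dotr cond_mean_measurable sA VM.
have isV : P.-integrable A (EFin \o (fun w => sigma ^+ 2 * enorm (V w) ^+ 2)).
  under [X in EFin \o X]eq_fun do rewrite enorm_sqr.
  exact: (integrableZl mA (sigma ^+ 2) iVV).
have leS := cond_variance_integral_le sA.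
(* Square integrability of the noise on [A] comes from the variance bound, as [V] is bounded
   there. *)
have iS : P.-integrable A (EFin \o (fun w => enorm (g w - V w) ^+ 2)).
  apply/integrableP; split.
    apply/measurable_EFinP; under eq_fun do rewrite enorm_sqr.
    apply: measurable_funTS; apply: measurable_dotr;
      by apply: random_vectorD => //; exact: random_vectorN.
  under eq_integral do rewrite /= ger0_norm ?sqr_ge0//.
  by rewrite (le_lt_trans leS)// integrable_lty.
have Sle : \int[P]_(w in A) (enorm (g w - V w) ^+ 2) <=
    \int[P]_(w in A) (sigma ^+ 2 * enorm (V w) ^+ 2).
  by apply: fine_le => //; exact: integrable_fin_num.
have gapE : gap = (fun w => (dotr (K w) (g w) - dotr (K w) (V w)) +
   C * (enorm (g w - V w) ^+ 2 - sigma ^+ 2 * enorm (V w) ^+ 2)).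
  apply/funext => w; rewrite /gap /K !enorm_sqr.
  rewrite !(dotrDl, dotrDr, dotrNl, dotrNr, dotrZl, dotrZr) (dotrC (g w) (V w)).
  by ring.
have i1 : P.-integrable A (EFin \o (fun w => dotr (K w) (g w) - dotr (K w) (V w))).
  exact: (integrableB mA iKg iKV).
have i2 : P.-integrable A
    (EFin \o (fun w => enorm (g w - V w) ^+ 2 - sigma ^+ 2 * enorm (V w) ^+ 2)).
  exact: (integrableB mA iS isV).
have i3 := integrableZl mA C i2.
rewrite gapE; split; first exact: (integrableD mA i1 i3).
rewrite RintegralD// RintegralB// KgV subrr add0r RintegralZl// RintegralB//.
by rewrite mulr_ge0_le0// subr_le0.
Qed.

(** Turns a pointwise one-step estimate into an inequality of integrals. Nonnegativity of [u] and
    [v] gives it a meaning even when both integrals are infinite. *)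
Lemma le_integral_gap A (u v : T -> R) : <<s gen >> A ->
  measurable_fun setT u -> measurable_fun setT v ->
  (forall w, 0 <= u w) -> (forall w, 0 <= v w) ->
  (forall w, u w <= v w + gap w) ->
  (\int[P]_(w in A) (u w)%:E <= \int[P]_(w in A) (v w)%:E)%E.
Proof.
move=> sA mu mv u0 v0 uv; have mA := sub_measurable sA.
(* Nothing is integrable on [A] a priori: exhaust [A] by events on which [H]
   and [V] are bounded. *)
pose F k := A `&` [set w | \sum_(i < m) (`|H w 0 i| + `|V w 0 i|) <= k%:R].
have sF k : <<s gen >> (F k).
  apply: (@measurableI _ (g_sigma_algebraType gen)) => //.
  rewrite -[X in measurable X]setTI; apply: measurable_fun_ler => //.
  apply: measurable_sum => i; apply: measurable_funD; apply: measurableT_comp => //.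
  exact: cond_mean_measurable.
have mF k := sub_measurable (sF k).
have ndF : nondecreasing_seq F.
  apply/nondecreasing_seqP => k; apply/subsetPset => w [Aw /= Dk]; split=> //=.
  by rewrite (le_trans Dk)// ler_nat.
have AE : A = \bigcup_k F k.
  apply/seteqP; split=> [w Aw|w [k _ []]//].
  exists (Num.truncn (\sum_(i < m) (`|H w 0 i| + `|V w 0 i|))).+1 => //; split=> //=.
  exact/ltW/truncnS_gt.
have leF k : (\int[P]_(w in F k) (u w)%:E <= \int[P]_(w in F k) (v w)%:E)%E.
  have le_norm w i : F k w -> `|H w 0 i| + `|V w 0 i| <= k%:R.
    move=> [_ /= Dk]; apply: le_trans Dk; rewrite (bigD1 i)//=.
    by rewrite lerDl sumr_ge0// => j _; rewrite addr_ge0.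
  have [||igap gap0] := @Rintegral_gap_le0 (F k) k%:R (sF k).
  - by move=> w i Fw; apply: le_trans (le_norm w i Fw); rewrite lerDl.
  - by move=> w i Fw; apply: le_trans (le_norm w i Fw); rewrite lerDr.
  have gap0E : (\int[P]_(w in F k) (gap w)%:E <= 0)%E.
    by rewrite -[X in (X <= _)%E]fineK ?lee_fin//; exact: integrable_fin_num.
  have [iP iN] := (integrable_funepos (mF k) igap, integrable_funeneg (mF k) igap).
  have fN := integrable_fin_num (mF k) iN.
  have mP := measurable_int P iP; have mN := measurable_int P iN.
  (* Add the finite integral of the negative part of [gap] to both sides. Pointwise
     [u + gap^- <= v + gap^+] with all terms nonnegative, and the integral of [gap^+] is at most
     that of [gap^-]. *)
  rewrite -(leeD2rE _ _ fN).
  apply: (@le_trans _ _ (\int[P]_(w in F k) (v w)%:E +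
                         \int[P]_(w in F k) (EFin \o gap)^\+ w)%E); last first.
    by rewrite leeD2l// -sube_le0 -integralE.
  have mEu (x : T -> R) : measurable_fun setT x -> measurable_fun (F k) (EFin \o x).
    by move=> mx; apply/measurable_EFinP; exact: measurable_funTS.
  rewrite -!ge0_integralD//; try by [exact: mEu|move=> w _; rewrite lee_fin].
  apply: ge0_le_integral => //.
  - by move=> w _; rewrite adde_ge0// lee_fin.
  - by apply: emeasurable_funD => //; exact: mEu.
  - by apply: emeasurable_funD => //; exact: mEu.
  move=> w _; rewrite funeposE funenegE /= -!EFin_max -!EFinD lee_fin.
  have := uv w; move: (gap w) => t.
  by have [t0|/ltW t0] := leP t 0;
    [rewrite max_l ?oppr_ge0//; lra|rewrite max_r ?oppr_le0//; lra].
have cvgF (x : T -> R) : measurable_fun setT x -> (forall w, 0 <= x w) ->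
    (\int[P]_(w in F k) (x w)%:E @[k --> \oo] --> \int[P]_(w in A) (x w)%:E)%E.
  move=> mx x0; rewrite AE; apply: ge0_nondecreasing_set_cvg_integral => //.
  - by move=> k; apply/measurable_EFinP; exact: measurable_funTS.
  - by move=> k w _; rewrite lee_fin.
by apply: lee_cvg_to (cvgF u mu u0) (cvgF v mv v0) _; near=> k.
Unshelve. all: end_near. Qed.

End conditional_mean_and_variance.

(** The generators inside [natural_filtration], named so that lemmas about [<<s gen >>] can be
    instantiated with it by conversion. *)
Definition filtration_gen (d : measure_display) (T : measurableType d)
    (R : realType) (m : nat) (X : nat -> T -> 'rV[R]_m) (n : nat) : set (set T) :=
  \bigcup_(k in [set k : nat | (k <= n)%N]) \bigcup_(i in [set: 'I_m])
    preimage_set_system setT (fun w => X k w 0 i) measurable.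

(** * Stochastic gradient descent *)

Section stochastic_gradient_descent.
Context {R : realType} {m : nat} {f : 'rV[R]_m -> R} {L sigma eta : R}
  {d : measure_display} {T : measurableType d} {P : probability T R}
  {X g : nat -> T -> 'rV[R]_m}.
Hypotheses (f_convex : convex_function setT f)
  (f_diff : forall x, differentiable f x) (L_gt0 : 0 < L)
  (f_smooth : forall x y, enorm (grad f x - grad f y) <= L * enorm (x - y))
  (eta_gt0 : 0 < eta)
  (eta_lt : eta < 1 / (L * (1 + sigma ^+ 2)))
  (X0_rv : random_vector (X 0%N)) (g_rv : forall n, random_vector (g n))
  (X_step : forall n w, X n.+1 w = X n w - eta *: g n w)
  (g_mean : forall n,
    is_cond_expectation_vec P (natural_filtration X n)
      (g n) (fun w => grad f (X n w)))
  (g_var : forall n,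
    cond_expectation_le P (natural_filtration X n)
      (fun w => (enorm (g n w - grad f (X n w)) ^+ 2)%:E)
      (fun w => (sigma ^+ 2 * enorm (grad f (X n w)) ^+ 2)%:E)).

Let X_rv n : random_vector (X n).
Proof.
elim: n => // n IH; rewrite (funext (X_step n)).
by apply: random_vectorD => //; apply: random_vectorN; exact: random_vectorZ.
Qed.

Let filtration_sub n : natural_filtration X n `<=` measurable.
Proof.
apply: smallest_sub; first exact: sigma_algebra_measurable.
by move=> _ [k _] [i _] [B mB <-]; exact: X_rv.
Qed.

Let X_adapted n : gen_random_vector (gen := filtration_gen X n) (X n).
Proof.
move=> i _ B mB; apply: sub_gen_smallest.
by exists n => /=; [|exists i => //; exists B].
Qed.

Let f_cont : continuous f.
Proof. by move=> x; exact/differentiable_continuous. Qed.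

Let fX_rv n : measurable_fun setT (fun w => f (X n w)).
Proof. exact: measurable_continuous_rV. Qed.

Let L_eta_lt1 : L * eta * (1 + sigma ^+ 2) < 1.
Proof.
have s0 : 0 < 1 + sigma ^+ 2 by rewrite ltr_wpDr ?sqr_ge0.
by move: eta_lt; rewrite ltr_pdivlMr ?mulr_gt0// mulrCA mulrA.
Qed.

Let f_step n w : f (X n.+1 w) <= f (X n w) - eta * dotr (grad f (X n w)) (g n w)
  + L / 2 * eta ^+ 2 * enorm (g n w) ^+ 2.
Proof.
have := smooth_upper_bound f_diff f_smooth (X n w) (- eta *: g n w).
rewrite X_step scaleNr dotrNr dotrZr -scaleNr enormZ normrN gtr0_norm// exprMn.
by rewrite mulrA.
Qed.

(** This is the decrease of the mean of [f] on [A], with negative parts moved across so that both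
    integrands are nonnegative. The coefficients [H] and [C] are those of [f_step]. *)
Let descent n A : natural_filtration X n A ->
  (\int[P]_(w in A) (Num.max (f (X n.+1 w)) 0 + Num.max (- f (X n w)) 0)%:E
   <= \int[P]_(w in A) (Num.max (f (X n w)) 0 + Num.max (- f (X n.+1 w)) 0)%:E)%E.
Proof.
move=> sA.
have mH : gen_random_vector (gen := filtration_gen X n)
  (fun w => - eta *: grad f (X n w)).
  by apply: random_vectorZ; exact: cond_mean_measurable (g_mean n).
have C0 : 0 <= L / 2 * eta ^+ 2 by rewrite mulr_ge0 ?sqr_ge0 ?divr_ge0 ?ltW.
have mX k : measurable_fun setT (fun w => Num.max (f (X k w)) 0).
  exact: measurable_maxr.
have mNX k : measurable_fun setT (fun w => Num.max (- f (X k w)) 0).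
  by apply: measurable_maxr => //; exact: measurableT_comp.
apply: (le_integral_gap (filtration_sub (n:=n)) (g_rv n) (g_mean n) (g_var n) mH C0 sA).
- exact: measurable_funD.
- exact: measurable_funD.
- by move=> w; rewrite addr_ge0// le_max lexx orbT.
- by move=> w; rewrite addr_ge0// le_max lexx orbT.
move=> w; have := f_step n w.
have maxE (t : R) : Num.max t 0 = t + Num.max (- t) 0.
  by have [t0|/ltW t0] := leP t 0;
    [rewrite max_l ?oppr_ge0//; lra|rewrite max_r ?oppr_le0//; lra].
rewrite (maxE (f (X n.+1 w))) (maxE (f (X n w))) !dotrZl -enorm_sqr.
(* The slack left after [f_step] is [eta * V2 * (1 - L * eta * (1 + sigma ^+ 2) / 2)], nonnegative
   by the step-size condition. *)
have := sqr_ge0 (enorm (grad f (X n w))).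
move: (enorm (grad f (X n w)) ^+ 2) => V2 V2_ge0.
have etaV2 : 0 <= eta * V2 by rewrite mulr_ge0// ltW.
have : 0 <= eta * V2 * (1 - L * eta * (1 + sigma ^+ 2)).
  by rewrite mulr_ge0// subr_ge0 ltW.
lra.
Qed.

Lemma expectation_nonincreasing n :
  ('E_P[fun w => f (X n.+1 w)] <= 'E_P[fun w => f (X n w)])%E.
Proof.
pose p k w := Num.max (f (X k w)) 0; pose q k w := Num.max (- f (X k w)) 0.
have mp k : measurable_fun setT (p k) by exact: measurable_maxr.
have mq k : measurable_fun setT (q k).
  by apply: measurable_maxr => //; exact: measurableT_comp.
have p0 k w : 0 <= p k w by rewrite le_max lexx orbT.
have q0 k w : 0 <= q k w by rewrite le_max lexx orbT.
have EE k : ('E_P[fun w => f (X k w)] =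
    \int[P]_w (p k w)%:E - \int[P]_w (q k w)%:E)%E.
  rewrite unlock integralE; congr (_ - _)%E.
    by apply: eq_integral => w _; rewrite funeposE -EFin_max.
  by apply: eq_integral => w _; rewrite funenegE -EFinN -EFin_max.
have DE A k l : natural_filtration X n A ->
    (\int[P]_(w in A) (p k w + q l w)%:E =
     \int[P]_(w in A) (p k w)%:E + \int[P]_(w in A) (q l w)%:E)%E.
  move=> sA; have mA := filtration_sub sA.
  rewrite -ge0_integralD//; try by [move=> w _; rewrite lee_fin|
    apply/measurable_EFinP; exact: measurable_funTS].
pose B := [set w | f (X n w) <= 0].
have sB : natural_filtration X n B.
  have mf : measurable_fun setT
      (fun w : g_sigma_algebraType (filtration_gen X n) => f (X n w)).
    by apply: measurable_continuous_rV => //; exact: X_adapted.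
  have : measurable (B : set (g_sigma_algebraType (filtration_gen X n))).
    by rewrite -[X in measurable X]setTI; apply: measurable_fun_ler.
  by [].
(* On [B] the positive part of [f (X n)] vanishes, so the descent inequality
   there compares negative parts even when both parts of [f (X n)] have
   infinite expectation. *)
have le_q : (\int[P]_w (q n w)%:E <= \int[P]_w (q n.+1 w)%:E)%E.
  have mB := filtration_sub sB.
  have -> : (\int[P]_w (q n w)%:E = \int[P]_(w in B) (q n w)%:E)%E.
    rewrite [RHS]integral_mkcond; apply: eq_integral => w _; rewrite patchE.
    case: ifPn => //; rewrite notin_setE /B/= => /negP; rewrite -ltNge => f0.
    by rewrite /q max_r// oppr_le0 ltW.
  apply: (@le_trans _ _ (\int[P]_(w in B) (q n.+1 w)%:E)%E); last first.
    by apply: ge0_subset_integral => //; [exact/measurable_EFinP|move=> w _; rewrite lee_fin].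
  have := descent sB; rewrite -!/(p _ _) -!/(q _ _) !DE//.
  have -> : (\int[P]_(w in B) (p n w)%:E = 0)%E.
    by apply: integral0_eq => w Bw; rewrite /p max_r.
  rewrite add0e; apply: le_trans; rewrite leeDr//.
  by apply: integral_ge0 => w _; rewrite lee_fin.
have sT : natural_filtration X n setT.
  exact: (@measurableT _ (g_sigma_algebraType (filtration_gen X n))).
have := descent sT; rewrite -!/(p _ _) -!/(q _ _) !DE// !EE => le_pq.
have q_ge0 k : (0 <= \int[P]_w (q k w)%:E)%E.
  by apply: integral_ge0 => w _; rewrite lee_fin.
(* If the negative part of [f (X n.+1)] has infinite integral, the left expectation is -oo, as
   adding -oo yields -oo even to +oo. Otherwise [le_q] makes both negative parts finite and [le_pq]
   can be rearranged. *)
have [q_fin|] := boolP (\int[P]_w (q n.+1 w)%:E \is a fin_num)%E; last first.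
  by rewrite ge0_fin_numE// ltNge leye_eq negbK => /eqP ->; rewrite addeNy leNye.
have q_fin' : (\int[P]_w (q n w)%:E \is a fin_num)%E.
  by rewrite ge0_fin_numE// (le_lt_trans le_q)// -ge0_fin_numE.
by rewrite leeBlDr// addeAC leeBrDr.
Qed.

(** * The potential argument around a minimizer *)

Section minimizer.
Context {xs : 'rV[R]_m}.
Hypothesis f_min : forall x, f xs <= f x.

Let K := eta * (1 + sigma ^+ 2) / (1 - L * (1 + sigma ^+ 2) * eta / 2).

Let K_ge0 : 0 <= K.
Proof.
have den_gt0 : 0 <= 1 - L * (1 + sigma ^+ 2) * eta / 2 by have := L_eta_lt1; lra.
by rewrite divr_ge0// mulr_ge0 ?(ltW eta_gt0)// addr_ge0 ?sqr_ge0.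
Qed.

(* The weight [K / 2] makes the [enorm (grad f x) ^+ 2] terms cancel in the
   conditional mean of [Phi n.+1]. *)
Let Phi n w := enorm (X n w - xs) ^+ 2 / 2 + K / 2 * (f (X n w) - f xs).

Let Phi_ge0 n w : 0 <= Phi n w.
Proof.
apply: addr_ge0; first by rewrite divr_ge0 ?sqr_ge0.
by apply: mulr_ge0; [rewrite divr_ge0|rewrite subr_ge0].
Qed.

Let gap_rv n : measurable_fun setT (fun w => f (X n w) - f xs).
Proof. exact: measurable_funB. Qed.

Let dist_rv n : measurable_fun setT (fun w => enorm (X n w - xs) ^+ 2).
Proof.
by under eq_fun do rewrite enorm_sqr; apply: measurable_dotr; exact: random_vectorD.
Qed.

Let Phi_rv n : measurable_fun setT (Phi n).
Proof.
by apply: measurable_funD; [exact: measurable_funM|exact: measurable_funM].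
Qed.

Let Phi_step n : (\int[P]_w (Phi n.+1 w)%:E +
  eta%:E * \int[P]_w (f (X n w) - f xs)%:E <= \int[P]_w (Phi n w)%:E)%E.
Proof.
rewrite -ge0_integralZl//; last 3 first.
- exact/measurable_EFinP.
- by move=> w _; rewrite lee_fin subr_ge0.
- by rewrite lee_fin ltW.
rewrite -ge0_integralD//; last 4 first.
- by move=> w _; rewrite lee_fin.
- exact/measurable_EFinP.
- by move=> w _; rewrite -EFinM lee_fin mulr_ge0 ?subr_ge0// ltW.
- by apply/measurable_EFinP; exact: measurable_funM.
(* [H] and [C] below collect the coefficients of [g n] and of its squared norm in [Phi n.+1]: the
   first summands come from expanding the squared distance, the second ones from [K / 2] times
   [f_step]. *)
have mH : gen_random_vector (gen := filtration_gen X n)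
  (fun w => - eta *: (X n w - xs) + - (K / 2 * eta) *: grad f (X n w)).
  apply: random_vectorD; apply: random_vectorZ.
    by apply: random_vectorD => //; exact: X_adapted.
  exact: cond_mean_measurable (g_mean n).
pose C := eta ^+ 2 / 2 + K / 2 * (L / 2 * eta ^+ 2).
have C0 : 0 <= C.
  apply: addr_ge0; first by rewrite divr_ge0 ?sqr_ge0.
  apply: mulr_ge0; first by rewrite divr_ge0.
  by rewrite mulr_ge0 ?sqr_ge0// divr_ge0// ltW.
under eq_integral do rewrite -EFinD.
have sT : natural_filtration X n setT.
  exact: (@measurableT _ (g_sigma_algebraType (filtration_gen X n))).
apply: (le_integral_gap (filtration_sub (n:=n)) (g_rv n) (g_mean n) (g_var n) mH C0 sT) => //.
- by apply: measurable_funD => //; exact: measurable_funM.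
- by move=> w; rewrite addr_ge0// mulr_ge0 ?subr_ge0// ltW.
move=> w; rewrite /Phi.
have fstep := f_step n w.
have cvx := convex_gradient_ineq f_diff f_smooth f_convex (X n w) xs.
rewrite X_step.
have -> : enorm (X n w - eta *: g n w - xs) ^+ 2 = enorm (X n w - xs) ^+ 2
    - 2 * eta * dotr (X n w - xs) (g n w) + eta ^+ 2 * enorm (g n w) ^+ 2.
  rewrite addrAC !enorm_sqr.
  rewrite !(dotrDl, dotrDr, dotrNl, dotrNr, dotrZl, dotrZr).
  rewrite (dotrC (g n w) (X n w)) (dotrC (g n w) xs).
  by ring.
rewrite X_step in fstep.
have Kf := ler_wpM2l (divr_ge0 K_ge0 (ler0n R 2)) fstep.
have ef := ler_wpM2l (ltW eta_gt0) cvx.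
(* By the choice of [K] the squared gradient terms cancel, through [KE] multiplied by
   [eta / 2 * V2]. What remains is at most [- eta * (f (X n w) - f xs)] by convexity. *)
have -> : dotr (- eta *: (X n w - xs) + - (K / 2 * eta) *: grad f (X n w))
      (grad f (X n w)) + C * (1 + sigma ^+ 2) * enorm (grad f (X n w)) ^+ 2 =
    eta * dotr (grad f (X n w)) (xs - X n w).
  rewrite -(opprB (X n w) xs) (dotrC _ (- _)) dotrDl dotrNl !dotrZl -enorm_sqr /C.
  have KE : K * (1 - L * (1 + sigma ^+ 2) * eta / 2) = eta * (1 + sigma ^+ 2).
    by rewrite /K divfK// gt_eqF//; have := L_eta_lt1; lra.
  move: (enorm (grad f (X n w)) ^+ 2) (dotr _ _) => V2 t.
  have := congr1 (fun z => z * (eta / 2) * V2) KE.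
  move: K => k; lra.
rewrite (dotrDl (- eta *: _)) !dotrZl /C.
move: (dotr (X n w - xs) (g n w)) (f (X n w - eta *: g n w)) Kf ef => t1 t2.
move: K => k; lra.
Qed.

Lemma sum_gap_le : (eta%:E * \sum_(0 <= n <oo) \int[P]_w (f (X n w) - f xs)%:E
  <= \int[P]_w (enorm (X 0%N w - xs) ^+ 2)%:E * (2^-1)%:E
     + K%:E * \int[P]_w (f (X 0%N w) - f xs)%:E)%E.
Proof.
have gap_ge0 n : (0 <= \int[P]_w (f (X n w) - f xs)%:E)%E.
  by apply: integral_ge0 => w _; rewrite lee_fin subr_ge0.
have int_Phi_ge0 n : (0 <= \int[P]_w (Phi n w)%:E)%E.
  by apply: integral_ge0 => w _; rewrite lee_fin.
have egap_ge0 n : (0 <= eta%:E * \int[P]_w (f (X n w) - f xs)%:E)%E.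
  by rewrite mule_ge0// lee_fin ltW.
(* Telescoped with the potential kept on the left, so no subtraction of possibly infinite integrals
   occurs. *)
have partial N : (\int[P]_w (Phi N w)%:E +
    \sum_(0 <= n < N) (eta%:E * \int[P]_w (f (X n w) - f xs)%:E)
    <= \int[P]_w (Phi 0%N w)%:E)%E.
  elim: N => [|N IH]; first by rewrite big_geq// adde0.
  apply: le_trans IH; rewrite big_nat_recr//= [X in (_ + X)%E]addeC addeA.
  by rewrite leeD2r.
apply: (@le_trans _ _ (\int[P]_w (Phi 0%N w)%:E)%E).
  rewrite -nneseriesZl//; apply: lime_le.
    by apply: is_cvg_nneseries => n _ _.
  near=> N; apply: le_trans (partial N); rewrite leeDr//.
have -> : (\int[P]_w (Phi 0%N w)%:E =
    \int[P]_w (enorm (X 0%N w - xs) ^+ 2)%:E * (2^-1)%:E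
    + (K / 2)%:E * \int[P]_w (f (X 0%N w) - f xs)%:E)%E.
  rewrite -ge0_integralZr//; last 2 first.
  - exact/measurable_EFinP.
  - by move=> w _; rewrite lee_fin sqr_ge0.
  have K2_ge0 : 0 <= K / 2 by rewrite divr_ge0.
  rewrite -ge0_integralZl//; last 2 first.
  - exact/measurable_EFinP.
  - by move=> w _; rewrite lee_fin subr_ge0.
  rewrite -ge0_integralD//.
  - by move=> w _; rewrite -EFinM lee_fin divr_ge0 ?sqr_ge0.
  - by apply/measurable_EFinP; exact: measurable_funM.
  - by move=> w _; rewrite -EFinM lee_fin mulr_ge0// subr_ge0.
  - by apply/measurable_EFinP; exact: measurable_funM.
(* The potential yields the constant [K / 2], which is relaxed to [K]. *)
rewrite leeD2l// lee_wpmul2r// lee_fin.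
by rewrite ler_pdivrMr// ler_peMr// ler1n.
Unshelve. all: end_near. Qed.
End minimizer.

End stochastic_gradient_descent.

(* No integrability of f (X n) is assumed: expectations are Lebesgue integrals
   in the extended reals, equal to -oo when positive and negative parts both
   have infinite integral. *)
Theorem lemma3p3 (R : realType) (m : nat)
  (f : 'rV[R]_m -> R) (L sigma eta : R)
  (d : measure_display) (T : measurableType d) (P : probability T R)
  (X g : nat -> T -> 'rV[R]_m)
  (f_convex : convex_function setT f)
  (f_diff : forall x, differentiable f x)
  (L_gt0 : 0 < L)
  (f_smooth : forall x y, enorm (grad f x - grad f y) <= L * enorm (x - y))
  (sigma_ge0 : 0 <= sigma)
  (eta_gt0 : 0 < eta)
  (eta_lt : eta < 1 / (L * (1 + sigma ^+ 2)))
  (X0_rv : random_vector (X 0%N))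
  (g_rv : forall n, random_vector (g n))
  (X_step : forall n w, X n.+1 w = X n w - eta *: g n w)
  (g_mean : forall n,
    is_cond_expectation_vec P (natural_filtration X n)
      (g n) (fun w => grad f (X n w)))
  (g_var : forall n,
    cond_expectation_le P (natural_filtration X n)
      (fun w => (enorm (g n w - grad f (X n w)) ^+ 2)%:E)
      (fun w => (sigma ^+ 2 * enorm (grad f (X n w)) ^+ 2)%:E)) :
  nonincreasing_seq (fun n => 'E_P[fun w => f (X n w)])%E /\
  (forall xs : 'rV[R]_m, (f xs)%:E = inf_fun f ->
    (eta%:E * \sum_(0 <= n <oo) \int[P]_w ((f (X n w))%:E - inf_fun f)
     <= 'E_P[fun w => (enorm (X 0%N w - xs) ^+ 2)%R] * (2^-1)%:E
        + (eta * (1 + sigma ^+ 2) / (1 - L * (1 + sigma ^+ 2) * eta / 2))%:E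
          * \int[P]_w ((f (X 0%N w))%:E - inf_fun f))%E).
Proof.
split; first by apply/nonincreasing_seqP => n; exact: (expectation_nonincreasing
    f_diff L_gt0 f_smooth eta_gt0 eta_lt X0_rv g_rv X_step g_mean g_var).
move=> xs inf_f.
have f_min x : f xs <= f x.
  by rewrite -lee_fin inf_f; apply: ereal_inf_lbound; exists x.
rewrite -inf_f [@expectation]unlock.
exact: (sum_gap_le f_convex f_diff L_gt0 f_smooth eta_gt0 eta_lt
  X0_rv g_rv X_step g_mean g_var f_min).
Qed.
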